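(* Let $m>n\ge2$ be relatively prime integers with Hirzebruch–Jung continued fraction $n/m=(E_1,\dots,E_k)$, and let $(\tilde n,q)$ be the integers with $mq-n\tilde n=-1$ and $\tilde n$ minimal positive. Let $x=(x_1,x_2)$ be an interior point of $\Delta_{n,m}=\{x\in\mathbb R^2:x_1\ge0,\ -nx_1+mx_2\ge0\}$ which is not in the region $$(E_1-1)\,x_2\le x_1\le\frac{m-(E_k-1)\tilde n}{n-(E_k-1)q}\,x_2 .$$ Then for every minimal resolution $(\overline M_{n,m},\overline\omega_\kappa,\overline\Delta_{n,m}(\kappa))$, with support constants $\kappa=(\kappa_1,\dots,\kappa_k)\in\mathbb R_{<0}^k$ sufficiently close to zero (so that $x\in\mathrm{Int}\,\overline\Delta_{n,m}(\kappa)$), the Lagrangian fiber $L_x\subset(\overline M_{n,m},\overline\omega_\kappa)$ can be displaced by extended probes in $\overline\Delta_{n,m}(\kappa)$.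
   Context: Continued fraction. Put $r_{-1}=m$, $r_0=n$, $E_{j+1}=\lceil r_{j-1}/r_j\rceil$, $r_{j+1}=E_{j+1}r_j-r_{j-1}$, and let $k$ be the smallest index with $r_k=0$; then $n/m=\frac{1}{E_1-\frac{1}{E_2-\cdots\frac1{E_k}}}$, with all $E_j\ge2$. Minimal resolution. Define conormals $\eta_0=(1,0)$, $\eta_1=(0,1)$, $\eta_{j+1}=E_j\eta_j-\eta_{j-1}$ for $1\le j\le k$, so $\eta_{k+1}=(-n,m)$. For $\kappa\in\mathbb R_{<0}^k$ let $$\overline\Delta_{n,m}(\kappa)=\{x\in\mathbb R^2:\langle\eta_0,x\rangle\ge0,\ \langle\eta_j,x\rangle+\kappa_j\ge0\ (1\le j\le k),\ \langle\eta_{k+1},x\rangle\ge0\}.$$ When $\kappa$ is such that this polytope has $k+2$ edges (it is then smooth), the corresponding symplectic toric manifold $(\overline M_{n,m},\overline\omega_\kappa,\overline\Phi_{n,m})$ with $\overline\Phi_{n,m}(\overline M_{n,m})=\overline\Delta_{n,m}(\kappa)$ is called a minimal resolution; $L_x=\overline\Phi_{n,m}^{-1}(x)$. A set $X$ is displaceable if some compactly supported Hamiltonian diffeomorphism $\phi$ satisfies $\phi(X)\cap\overline X=\emptyset$. Extended probes in a rational polygon $\Delta$ (facets $F\subset\{\langle\eta_F,x\rangle+\kappa_F=0\}$, $\eta_F$ primitive interior conormal). If $x-y=tv$ with $v$ primitive integral, $d_{\mathrm{aff}}(x,y)=|t|$; $d_{\mathrm{aff}}(x,F)=|\langle\eta_F,x\rangle+\kappa_F|$.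 A probe $P$ is a directed segment in $\Delta$ from $b_P$ in the interior of a facet $F_P$ to $b_P+\ell(P)v_P$, with $v_P\in\mathbb Z^2$ primitive and $\langle\eta_{F_P},v_P\rangle=1$; $\ell(P)$ is its length. A point $u\in\mathrm{Int}\,\Delta$ can be displaced by extended probes if one of the following holds (each implies that $L_u$ is displaceable): (a) $u\in P$ for a probe $P$ and $d_{\mathrm{aff}}(u,F_P)<\frac12\ell(P)$. (b) There are a symmetric probe $Q$ (its endpoint lies in the interior of a facet $F_Q'$ with $\langle\eta_{F_Q'},v_Q\rangle=-1$), with affine reflection $A_Q(x)=x+\langle\eta_{F_Q'}-\eta_{F_Q},x\rangle v_Q+(\kappa_{F_Q'}-\kappa_{F_Q})v_Q$ and linear part $\widehat A_Q$, a probe $P$ ending at $x_{PQ}$ in the interior of $Q$, and a segment $P'\subset\Delta$ from $x_{PQ}'=A_Q(x_{PQ})$ to $x'_{PQ}+\ell(P')\widehat A_Q(v_P)$, such that either $u\in\mathrm{Int}\,P$ and $d_{\mathrm{aff}}(u,F_P)<\frac12(\ell(P)+\ell(P'))$, or $u\in\mathrm{Int}\,P'$ and $\ell(P)+d_{\mathrm{aff}}(x'_{PQ},u)<\frac12(\ell(P)+\ell(P'))$ (symmetric extended probe). (c) There are probes $P,Q$ with $P$ ending at $x_{PQ}\in Q$ and $v_P$ parallel to $F_Q$, points $x_{\mathcal F},x_{\mathcal F}'\in Q$ and $\ell(\mathcal F)\ge0$ such that the convex hull of $x_{\mathcal F},x'_{\mathcal F},x_{\mathcal F}+\ell(\mathcal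 F)v_P,x'_{\mathcal F}+\ell(\mathcal F)v_P$ lies in $\Delta$, $u\in\mathrm{Int}\,P$, $d_{\mathrm{aff}}(u,F_P)<\frac12(\ell(P)+\ell(\mathcal F))$ and $d_{\mathrm{aff}}(x_{PQ},F_Q)<d_{\mathrm{aff}}(x_{\mathcal F},x'_{\mathcal F})$ (parallel extended probe with flag). *)

(* Defs.v *)
(* MathComp + MathComp-Analysis; the real plane is [R * R] with R : realType. *)
From HB Require Import structures.
From mathcomp Require Import all_boot all_order all_algebra.
From mathcomp Require Import mathcomp_extra boolp classical_sets functions.
From mathcomp Require Import cardinality reals topology normedtype.
From mathcomp Require Import ring.

Set Implicit Arguments.
Unset Strict Implicit.
Unset Printing Implicit Defensive.

Import Order.TTheory GRing.Theory Num.Theory numFieldNormedType.Exports.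

Local Open Scope classical_set_scope.
Local Open Scope ring_scope.

Definition ceil_ratio (a b : int) : int := Num.ceil (a%:Q / b%:Q).

(* [hj_rem m n i] is the remainder r_{i-1}, so that r_{-1} = m and r_0 = n are
   the values at 0 and 1.  The recursion is meaningful until the first zero
   remainder; later values are junk and never used. *)
Fixpoint hj_rem (m n : nat) (i : nat) {struct i} : int :=
  match i with
  | 0%N => m%:Z
  | 1%N => n%:Z
  | (i'.+1 as j).+1 =>
      ceil_ratio (hj_rem m n i') (hj_rem m n j) * hj_rem m n j - hj_rem m n i'
  end.

(* E_j = ceil (r_{j-2} / r_{j-1}), for 1 <= j <= k. *)
Definition hj_coef (m n j : nat) : int :=
  ceil_ratio (hj_rem m n j.-1) (hj_rem m n j).

(* k is the smallest index with r_k = 0. *)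
Definition hj_length (m n k : nat) : Prop :=
  hj_rem m n k.+1 = 0 /\ forall j, (j < k)%N -> hj_rem m n j.+1 != 0.

(* eta_{j+2} = E_{j+1} eta_{j+1} - eta_j *)
Fixpoint hj_conormal (E : nat -> int) (j : nat) {struct j} : int * int :=
  match j with
  | 0%N => (1, 0)
  | 1%N => (0, 1)
  | (i.+1 as j').+1 => hj_conormal E j' *~ E j' - hj_conormal E i
  end.

Definition primitive (v : int * int) : bool := coprimez v.1 v.2.

Lemma hj_conormalSS E j :
  hj_conormal E j.+2 =
    (E j.+1 * (hj_conormal E j.+1).1 - (hj_conormal E j).1,
     E j.+1 * (hj_conormal E j.+1).2 - (hj_conormal E j).2).
Proof.
have -> : hj_conormal E j.+2
    = hj_conormal E j.+1 *~ E j.+1 - hj_conormal E j by [].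
by rewrite [LHS]surjective_pairing (raddfB fst) (raddfB snd)
  (raddfMz fst) (raddfMz snd) !mulrzz !(mulrC (E _)).
Qed.

Lemma hj_conormal_det E j :
  (hj_conormal E j).1 * (hj_conormal E j.+1).2
    - (hj_conormal E j).2 * (hj_conormal E j.+1).1 = 1.
Proof.
elim: j => [|j IH]; first by rewrite /= mulr1 mul0r subr0.
by rewrite -[RHS]IH hj_conormalSS /=; ring.
Qed.

Lemma hj_conormal_primitive E j : primitive (hj_conormal E j).
Proof.
apply/coprimezP; exists ((hj_conormal E j.+1).2, - (hj_conormal E j.+1).1).
by rewrite -[RHS](hj_conormal_det E j) /=; ring.
Qed.

Section Plane.
Context {R : realType}.
Implicit Types (x y u : R * R) (eta v : int * int).

Definition to_plane v : R * R := (v.1%:~R, v.2%:~R).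

Definition pairing eta x : R := eta.1%:~R * x.1 + eta.2%:~R * x.2.

(* [aff_dist x y d] is d_aff(x, y) = d; it is a partial function of (x, y),
   defined when x - y has a rational direction. *)
Definition aff_dist x y (d : R) : Prop :=
  exists v (t : R), [/\ primitive v, x - y = t *: to_plane v & d = `|t|].

(* The segment from b to b + l w, and its relative interior. *)
Definition segment (b w : R * R) (l : R) : set (R * R) :=
  [set x | exists t : R, 0 <= t <= l /\ x = b + t *: w].

Definition open_segment (b w : R * R) (l : R) : set (R * R) :=
  [set x | exists t : R, 0 < t < l /\ x = b + t *: w].

Definition convex_hull (N : nat) (p : 'I_N -> R * R) : set (R * R) :=
  [set x | exists w : 'I_N -> R,
     [/\ forall i, 0 <= w i, \sum_i w i = 1 & x = \sum_i w i *: p i]].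

End Plane.

Record rational_polygon (R : realType) := RationalPolygon {
  side : finType;
  conormal : side -> int * int;
  support : side -> R;
  conormal_primitive : forall i, primitive (conormal i)
}.

Section Polygon.
Context {R : realType} (D : rational_polygon R).
Implicit Types (i : side D) (x u : R * R).

(* <eta_i, x> + kappa_i *)
Definition height i x : R := pairing (conormal i) x + support i.

Definition region : set (R * R) := [set x | forall i, 0 <= height i x].

Definition facet i : set (R * R) := [set x | region x /\ height i x = 0].

(* Interior of the facet relative to the line that supports it; empty when the
   line meets the polygon in at most a vertex. *)
Definition facet_interior i : set (R * R) :=
  [set x | facet i x /\ \forall y \near x, height i y = 0 -> facet i y].

Definition edges : set (set (R * R)) :=
  [set F | (exists i, F = facet i) /\
           exists y z : R * R, [/\ F y, F z & y != z]].

Definition dist_facet x i : R := `|height i x|.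

Record probe := Probe {
  base : R * R;
  base_facet : side D;
  dir : int * int;
  len : R
}.

Definition tip (P : probe) : R * R := base P + len P *: to_plane (dir P).

Definition probe_set (P : probe) : set (R * R) :=
  segment (base P) (to_plane (dir P)) (len P).

Definition probe_interior (P : probe) : set (R * R) :=
  open_segment (base P) (to_plane (dir P)) (len P).

Definition is_probe (P : probe) : Prop :=
  [/\ facet_interior (base_facet P) (base P),
      primitive (dir P),
      pairing (conormal (base_facet P)) (to_plane (dir P)) = 1 :> R,
      0 < len P &
      probe_set P `<=` region].

Definition is_symmetric_probe (Q : probe) (F' : side D) : Prop :=
  [/\ is_probe Q,
      facet_interior F' (tip Q) &
      pairing (conormal F') (to_plane (dir Q)) = -1 :> R].

Definition reflection_lin (Q : probe) (F' : side D) x : R * R :=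
  x + (pairing (conormal F' - conormal (base_facet Q)) x)
        *: to_plane (dir Q).

Definition reflection (Q : probe) (F' : side D) x : R * R :=
  reflection_lin Q F' x
    + (support F' - support (base_facet Q)) *: to_plane (dir Q).

Definition displaced_by_probe u : Prop :=
  exists P : probe,
    [/\ is_probe P, probe_set P u & dist_facet u (base_facet P) < len P / 2].

Definition displaced_by_symmetric_extended_probe u : Prop :=
  exists (P Q : probe) (F' : side D) (l' : R),
    let x' := reflection Q F' (tip P) in
    let v' := reflection_lin Q F' (to_plane (dir P)) in
    [/\ is_probe P, is_symmetric_probe Q F', probe_interior Q (tip P),
        0 <= l' /\ segment x' v' l' `<=` region &
        (probe_interior P u /\
         dist_facet u (base_facet P) < (len P + l') / 2)
        \/
        (open_segment x' v' l' u /\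
         exists d, aff_dist x' u d /\ len P + d < (len P + l') / 2)].

(* [xF], [xF'] and [lF] describe the flag. *)
Definition displaced_by_parallel_extended_probe u : Prop :=
  exists (P Q : probe) (xF xF' : R * R) (lF : R),
    [/\ [/\ is_probe P, is_probe Q & probe_set Q (tip P)],
        pairing (conormal (base_facet Q)) (to_plane (dir P)) = 0 :> R,
        [/\ probe_set Q xF, probe_set Q xF' & 0 <= lF],
        convex_hull (tnth [tuple xF; xF'; xF + lF *: to_plane (dir P);
                                 xF' + lF *: to_plane (dir P)]) `<=` region &
        [/\ probe_interior P u,
            dist_facet u (base_facet P) < (len P + lF) / 2 &
            exists d, aff_dist xF xF' d /\
                      dist_facet (tip P) (base_facet Q) < d]].

(* To be used for u in the interior of the polygon. *)
Definition displaced_by_extended_probes u : Prop :=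
  [\/ displaced_by_probe u,
      displaced_by_symmetric_extended_probe u |
      displaced_by_parallel_extended_probe u].

End Polygon.

(* The sides are numbered 0, ..., k+1; the two outer support constants are 0
   and the others are kappa_1, ..., kappa_k. *)
Definition resolution_polygon (R : realType) (m n k : nat) (kappa : k.-tuple R)
    : rational_polygon R :=
  @RationalPolygon R 'I_k.+2
    (fun j => hj_conormal (hj_coef m n) j)
    (fun j => nth 0 (0 :: rcons kappa 0) j)
    (fun j => hj_conormal_primitive (hj_coef m n) j).

(* The polygon has the full number k+2 of edges, i.e. it is the moment polygon
   of a minimal resolution. *)
Definition is_minimal_resolution (R : realType) (m n k : nat)
    (kappa : k.-tuple R) : Prop :=
  (forall j : 'I_k, tnth kappa j < 0) /\
  (edges (resolution_polygon m n kappa) #= `I_k.+2)%card.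

Definition cone (R : realType) (m n : nat) : set (R * R) :=
  [set x | 0 <= x.1 /\ 0 <= - n%:R * x.1 + m%:R * x.2].

(* Main.v *)
Require Import Defs.
From mathcomp Require Import all_boot all_order all_algebra.
From mathcomp Require Import mathcomp_extra boolp classical_sets functions.
From mathcomp Require Import cardinality reals topology normedtype.
From mathcomp Require Import ring lra zify.
Import Order.TTheory GRing.Theory Num.Theory numFieldNormedType.Exports.
Local Open Scope classical_set_scope.
Local Open Scope ring_scope.

(** Write [eta_0], ..., [eta_(k+1)] for the conormals and call the sides [0] and
    [k+1] outer.  The complement of the excluded region in the cone is a union
    of two sectors, one along each outer side, and the same argument displaces
    both.  Let [s] be the outer side, [t] the neighbouring side, [(e, f)] the
    basis of the lattice dual to [(eta_s, eta_t)], and [E] the continued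
    fraction coefficient attached to [t].  The boundary ray of the sector is
    spanned by [w = (E - 1) e + f], and [x] lies in the sector exactly when
    [0 < <eta_s, x> < (E - 1) <eta_t, x>].

    Start a probe [Q] in the interior of the short edge [t], in the direction
    [w].  Since [w] pairs positively with every conormal, the polygon contains
    the whole ray, hence [Q] can be made as long as desired, and the polygon
    contains arbitrarily wide strips [Q + [0, l] e] if one goes far enough out
    along [Q].  As the support constants tend to zero, [Q] tends to the boundary
    ray of the sector, so the probe [P] that starts in the edge [s], runs in the
    direction [e] parallel to the edge [t] and passes through [x] meets [x]
    before it reaches [Q].  A flag far out on [Q], longer along [Q] than the
    distance from the tip of [P] to [t] and wider than the distance from [x] to
    [s], then displaces [x]: this is [displaced_near_end].

    Two facts about the conormals are used: [f] pairs positively with all of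
    them except [eta_s], and [w] pairs positively with all of them.  Along the
    recursion [eta_(j+2) = E_(j+1) eta_(j+1) - eta_j] the pairings with a fixed
    vector form a sequence which, as all [E_j] are at least [2], stays positive
    from any step on at which it is positive and does not decrease, in both
    directions ([convex_recurrence_ge1]); so only the pairings with two
    neighbouring conormals have to be computed.
    For the side [k+1] these are [eta_(k+1) = (-n, m)] and [eta_k = (-q, nt)],
    which is where the minimality of [nt] enters ([last_conormals]).  That the
    edge [t] has an interior is guaranteed by the number of edges of the
    polygon ([resolution_facet_nontrivial]). *)

(** * Pairings and heights *)

Lemma pairingDZ (R : realType) (eta : int * int) (y v : R * R) (t : R) :
  pairing eta (y + t *: v) = pairing eta y + t * pairing eta v.
Proof.
rewrite /pairing -[(y + t *: v).1]/(y.1 + t * v.1).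
by rewrite -[(y + t *: v).2]/(y.2 + t * v.2); ring.
Qed.

Lemma heightDZ (R : realType) (D : rational_polygon R) (i : side D)
    (y v : R * R) (t : R) :
  height i (y + t *: v) = height i y + t * pairing (conormal i) v.
Proof. by rewrite /height pairingDZ addrAC. Qed.

Lemma pairing1_primitive (R : realType) (eta v : int * int) :
  pairing eta (to_plane v) = 1 :> R -> primitive v.
Proof.
rewrite /pairing /= -!intrM -intrD => /eqP; rewrite -[1]/(1%:~R) eqr_int.
by move=> /eqP eta_v; apply/coprimezP; exists eta.
Qed.

Lemma pairing_continuous (R : realType) (eta : int * int) (x : R * R) :
  pairing eta y @[y --> x] --> pairing eta x.
Proof.
by apply: cvgD; apply: cvgMl_tmp; [exact: cvg_fst | exact: cvg_snd].
Qed.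

Lemma height_continuous (R : realType) (D : rational_polygon R) (i : side D)
    (x : R * R) :
  height i y @[y --> x] --> height i x.
Proof. by apply: cvgD; [exact: pairing_continuous | exact: cvg_cst]. Qed.

Lemma interior_region (R : realType) (D : rational_polygon R) (x : R * R) :
  (forall i : side D, 0 < height i x) -> interior (region D) x.
Proof.
move=> x_gt0.
suff : \near x, forall i : side D, 0 <= height i x by [].
apply: (@filter_forall _ _ (fun i y => 0 <= height i y) (nbhs x)) => i.
have pos := height_continuous _ _ i x _ (lt_nbhsr (x_gt0 i)).
by near=> y; apply/ltW; near: y; exact: pos.
Unshelve. all: by end_near.
Qed.

Lemma interior_halfplane_gt0 (R : realType) (eta v : int * int)
    (A : set (R * R)) (x : R * R) :
  pairing eta (to_plane v) = 1 :> R ->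
  (forall y, A y -> 0 <= pairing eta y) -> interior A x -> 0 < pairing eta x.
Proof.
move=> eta_v A_ge0 Ax.
have line_cvg : x + t *: to_plane v @[t --> (0 : R)] --> x.
  rewrite -[X in _ --> X]addr0 -(scale0r (to_plane v)).
  by apply: cvgD; [exact: cvg_cst | apply: cvgZr_tmp; exact: cvg_id].
have : \forall t \near (0 : R), A (x + t *: to_plane v) by exact: line_cvg A Ax.
case/nbhs_ballP => d /= d_gt0 /(_ (- (d / 2))) /= A_back.
have := A_ge0 _ (A_back _); rewrite pairingDZ eta_v mulr1 => pos.
suff : d / 2 <= pairing eta x by apply: lt_le_trans; rewrite divr_gt0.
rewrite -subr_ge0; apply: pos.
by rewrite /ball /= sub0r opprK gtr0_norm; lra.
Qed.

(** * Points in the interior of a facet *)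

Lemma facet_interior_gt0 (R : realType) (D : rational_polygon R) (s : side D)
    (y : R * R) :
  height s y = 0 -> (forall i : side D, i != s -> 0 < height i y) ->
  facet_interior s y.
Proof.
move=> sy0 y_gt0.
have y_in : region D y.
  by move=> i; have [->|/y_gt0/ltW//] := eqVneq i s; rewrite sy0.
split; first by [].
suff : \near y, forall i : side D, i != s -> 0 <= height i y.
  move=> near_y; near=> z => sz0; split=> // i.
  have [->|] := eqVneq i s; first by rewrite sz0.
  by move: i; near: z.
apply: (@filter_forall _ _ (fun i z => i != s -> 0 <= height i z) (nbhs y)) => i.
have [->|i_s] := eqVneq i s; first by near=> z.
have pos := height_continuous _ _ i y _ (lt_nbhsr (y_gt0 i i_s)).
by near=> z => _; apply/ltW; near: z; exact: pos.
Unshelve. all: by end_near.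
Qed.

(** The direction [w] of the probe that carries the flag. *)
Definition end_dir (e f : int * int) (c : int) : int * int :=
  (c * e.1 + f.1, c * e.2 + f.2).

(** What the displacement argument needs to know about an outer side [s], its
    neighbour [t] and the directions: [e] is the direction of the probe through
    the displaced point, [f] that of the side [s] away from the vertex, and [c]
    is [E - 1] for the continued fraction coefficient [E] attached to [t]. *)
Record end_frame (R : realType) (D : rational_polygon R) (s t : side D)
    (e f : int * int) (c : int) : Prop := EndFrame {
  pair_se : pairing (conormal s) (to_plane e) = 1 :> R;
  pair_te : pairing (conormal t) (to_plane e) = 0 :> R;
  pair_sf : pairing (conormal s) (to_plane f) = 0 :> R;
  pair_tf : pairing (conormal t) (to_plane f) = 1 :> R;
  slope_gt0 : 0 < c;
  pair_f_ge1 : forall i : side D, i != s ->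
    1 <= pairing (conormal i) (to_plane f) :> R;
  pair_w_ge1 : forall i : side D,
    1 <= pairing (conormal i) (to_plane (end_dir e f c)) :> R
}.

Arguments pair_se {R D s t e f c} _.
Arguments pair_te {R D s t e f c} _.
Arguments slope_gt0 {R D s t e f c} _.
Arguments pair_w_ge1 {R D s t e f c} _ i.
Arguments pair_f_ge1 {R D s t e f c} _ i _.

(** The matrices with rows [eta], [zeta] and with columns [e], [f] have product
    [1] in one order, hence also in the other. *)
Lemma dual_basis_decomp (R : realType) (eta zeta e f : int * int) (y : R * R) :
  pairing eta (to_plane e) = 1 :> R -> pairing zeta (to_plane e) = 0 :> R ->
  pairing eta (to_plane f) = 0 :> R -> pairing zeta (to_plane f) = 1 :> R ->
  y = pairing eta y *: to_plane e + pairing zeta y *: to_plane f.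
Proof.
case: y eta zeta e f => [y1 y2] [s1 s2] [t1 t2] [e1 e2] [f1 f2].
rewrite /pairing /to_plane /=.
set S1 : R := s1%:~R; set S2 : R := s2%:~R; set T1 : R := t1%:~R.
set T2 : R := t2%:~R; set U1 : R := e1%:~R; set U2 : R := e2%:~R.
set V1 : R := f1%:~R; set V2 : R := f2%:~R => se te sf tf.
have det1 : (S1 * T2 - S2 * T1) * (U1 * V2 - U2 * V1) = 1.
  transitivity ((S1 * U1 + S2 * U2) * (T1 * V1 + T2 * V2)
                - (S1 * V1 + S2 * V2) * (T1 * U1 + T2 * U2)); first by ring.
  by rewrite se te sf tf; ring.
have det_neq0 : S1 * T2 - S2 * T1 != 0.
  by apply/eqP => det0; move: det1; rewrite det0 mul0r => /esym/eqP; rewrite oner_eq0.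
have E1 : U1 * (S1 * T2 - S2 * T1) = T2.
  transitivity ((S1 * U1 + S2 * U2) * T2 - S2 * (T1 * U1 + T2 * U2)); first by ring.
  by rewrite se te; ring.
have E2 : U2 * (S1 * T2 - S2 * T1) = - T1.
  transitivity (S1 * (T1 * U1 + T2 * U2) - (S1 * U1 + S2 * U2) * T1); first by ring.
  by rewrite se te; ring.
have F1 : V1 * (S1 * T2 - S2 * T1) = - S2.
  transitivity ((S1 * V1 + S2 * V2) * T2 - S2 * (T1 * V1 + T2 * V2)); first by ring.
  by rewrite sf tf; ring.
have F2 : V2 * (S1 * T2 - S2 * T1) = S1.
  transitivity (S1 * (T1 * V1 + T2 * V2) - (S1 * V1 + S2 * V2) * T1); first by ring.
  by rewrite sf tf; ring.
congr pair; apply: (mulIf det_neq0).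
  rewrite -[(_ + _) * _]/(((S1 * y1 + S2 * y2) * U1
     + (T1 * y1 + T2 * y2) * V1) * (S1 * T2 - S2 * T1)).
  transitivity ((S1 * y1 + S2 * y2) * (U1 * (S1 * T2 - S2 * T1))
                + (T1 * y1 + T2 * y2) * (V1 * (S1 * T2 - S2 * T1))).
    by rewrite E1 F1; ring.
  by ring.
rewrite -[(_ + _) * _]/(((S1 * y1 + S2 * y2) * U2
     + (T1 * y1 + T2 * y2) * V2) * (S1 * T2 - S2 * T1)).
transitivity ((S1 * y1 + S2 * y2) * (U2 * (S1 * T2 - S2 * T1))
                + (T1 * y1 + T2 * y2) * (V2 * (S1 * T2 - S2 * T1))).
  by rewrite E2 F2; ring.
by ring.
Qed.

Lemma frame_inj (R : realType) (D : rational_polygon R) (s t : side D)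
    (e f : int * int) (c : int) (y z : R * R) :
  end_frame R D s t e f c ->
  pairing (conormal s) y = pairing (conormal s) z ->
  pairing (conormal t) y = pairing (conormal t) z -> y = z.
Proof.
case=> se te sf tf _ _ _ sy ty.
rewrite (dual_basis_decomp R _ _ e f y se te sf tf) sy ty.
by rewrite -dual_basis_decomp.
Qed.

Lemma height_frame (R : realType) (D : rational_polygon R) (s t i : side D)
    (e f : int * int) (c : int) (y : R * R) :
  end_frame R D s t e f c ->
  height i y = pairing (conormal s) y * pairing (conormal i) (to_plane e)
             + pairing (conormal t) y * pairing (conormal i) (to_plane f)
             + Defs.support i.
Proof.
case=> se te sf tf _ _ _.
rewrite /height {1}(dual_basis_decomp R _ _ e f y se te sf tf) pairingDZ.
rewrite -[_ *: to_plane e]add0r pairingDZ.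
by rewrite {1}/pairing /= !mulr0 addr0 add0r.
Qed.

(** On the line that supports [t] the [s]-coordinate parametrizes the points, and
    all heights are affine in it; so the facet contains everything between [y]
    and [z], and the midpoint is interior. *)
Lemma facet_interior_nonempty (R : realType) (D : rational_polygon R)
    (s t : side D) (e f : int * int) (c : int) (y z : R * R) :
  end_frame R D s t e f c -> facet t y -> facet t z -> y != z ->
  exists b, facet_interior t b.
Proof.
move=> fr.
wlog yz : y z / pairing (conormal s) y < pairing (conormal s) z.
  move=> wl ty tz y_z.
  have [yz|zy|eq_s] := ltgtP (pairing (conormal s) y) (pairing (conormal s) z).
  - exact: wl yz ty tz y_z.
  - by apply: wl zy tz ty _; rewrite eq_sym.
  case/eqP: y_z; apply: frame_inj fr eq_s _.
  by apply: (addIr (Defs.support t)); case: ty tz => _ + [_]; rewrite /height => -> ->.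
move=> [y_in ty] [z_in tz] _.
have between b : pairing (conormal s) y <= pairing (conormal s) b ->
    pairing (conormal s) b <= pairing (conormal s) z -> height t b = 0 ->
    facet t b.
  move=> yb bz tb; split=> // i.
  have := y_in i; have := z_in i.
  rewrite !(height_frame _ _ s t i e f c _ fr).
  have -> : pairing (conormal t) b = pairing (conormal t) y.
    by apply: (addIr (Defs.support t)); move: tb ty; rewrite /height => -> ->.
  have -> : pairing (conormal t) z = pairing (conormal t) y.
    by apply: (addIr (Defs.support t)); move: tz ty; rewrite /height => -> ->.
  rewrite -!addrA; move: (_ * _ + Defs.support i) => k.
  by have [p_ge0|p_lt0] := lerP 0 (pairing (conormal i) (to_plane e) : R); nra.
pose b := y + ((pairing (conormal s) z - pairing (conormal s) y) / 2) *: to_plane e.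
have sb : pairing (conormal s) b
    = (pairing (conormal s) y + pairing (conormal s) z) / 2.
  by rewrite pairingDZ (pair_se fr); lra.
have tb : height t b = 0 by rewrite heightDZ (pair_te fr) mulr0 addr0.
exists b; split; first by apply: between; rewrite ?sb //; lra.
have cont := pairing_continuous _ (conormal s) b.
have near_gt := cont _ (lt_nbhsr (_ : pairing (conormal s) y < _)).
have near_lt := cont _ (lt_nbhsl (_ : _ < pairing (conormal s) z)).
near=> b' => tb'; apply: between => //; apply/ltW; near: b'.
  by apply: near_gt; rewrite sb; lra.
by apply: near_lt; rewrite sb; lra.
Unshelve. all: by end_near.
Qed.

(** * Displacing a point near an outer side *)

Lemma pairing_end_dir (R : realType) (eta e f : int * int) (c : int) :
  pairing eta (to_plane (end_dir e f c))
    = c%:~R * pairing eta (to_plane e) + pairing eta (to_plane f) :> R.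
Proof. by rewrite /pairing /= !intrD !intrM; ring. Qed.

(** With [r = a / c], the point is [x = r w + (b - r) f], a positive combination
    of two directions that pair to at least [1] with the conormal of each side
    [i] other than [s].  So [<eta_i, x>] is at least [b], and the support constant
    takes away less than [b - r]. *)
Lemma height_end_gt0 (R : realType) (D : rational_polygon R) (s t : side D)
    (e f : int * int) (c : int) (x : R * R) :
  let a := pairing (conormal s) x in let b := pairing (conormal t) x in
  end_frame R D s t e f c -> Defs.support s = 0 -> 0 < a ->
  (forall i : side D, - Defs.support i < b - a / c%:~R) ->
  forall i : side D, 0 < height i x.
Proof.
move=> a b fr s0 a_gt0 small i.
have C_gt0 : 0 < c%:~R :> R by rewrite ltr0z (slope_gt0 fr).
have [-> | i_s] := eqVneq i s; first by rewrite /height s0 addr0.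
have := small s; rewrite s0 oppr0; have := small i.
have r_gt0 : 0 < a / c%:~R by rewrite divr_gt0.
have aE : a = a / c%:~R * c%:~R by rewrite divfK// gt_eqF.
rewrite (height_frame _ _ s t i e f c _ fr) -/a -/b {3}aE.
have := pair_w_ge1 fr i; rewrite pairing_end_dir.
have := pair_f_ge1 fr i i_s.
move: (a / _) r_gt0 {aE C_gt0 a_gt0 small} => r; move: (c%:~R : R) => C.
move: (pairing _ (to_plane e)) (pairing _ (to_plane f)) (Defs.support i) b => p q k b.
move=> r_gt0 q1 w1 small_i br.
have : 0 <= r * (C * p + q - 1) by apply: mulr_ge0; lra.
have : 0 <= (b - r) * (q - 1) by apply: mulr_ge0; lra.
nra.
Qed.

Lemma convex_hull_region (R : realType) (D : rational_polygon R) (N : nat)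
    (p : 'I_N -> R * R) :
  (forall j, region D (p j)) -> convex_hull p `<=` region D.
Proof.
move=> p_in y [w [w_ge0 w_sum ->]] i.
suff -> : height i (\sum_j w j *: p j) = \sum_j w j * height i (p j).
  by apply: sumr_ge0 => j _; rewrite mulr_ge0 ?p_in.
have pairing_sum : pairing (conormal i) (\sum_j w j *: p j)
    = \sum_j w j * pairing (conormal i) (p j).
  elim/big_rec2: _ => [|j u r _ <-]; first by rewrite /pairing !mulr0 addr0.
  by rewrite addrC pairingDZ addrC.
rewrite /height pairing_sum; under [RHS]eq_bigr do rewrite mulrDr.
by rewrite big_split /= -mulr_suml w_sum mul1r.
Qed.

(** The parallel extended probe with flag.  The probe [Q] starts at the given point
    [z] of the edge [t] and follows [w]; the probe [P] passes through [x] in the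
    direction [e].  The bound on the support constants, applied to [t], puts [x]
    strictly before the point where [P] meets [Q]; applied to the other sides, it
    puts the base of [P] in the interior of the edge [s]. *)
Lemma displaced_near_end (R : realType) (D : rational_polygon R) (s t : side D)
    (e f : int * int) (c : int) (x z : R * R) :
  let a := pairing (conormal s) x in let b := pairing (conormal t) x in
  end_frame R D s t e f c -> Defs.support s = 0 -> facet_interior t z ->
  0 < a ->
  (forall i : side D, - Defs.support i < b - a / c%:~R) ->
  displaced_by_parallel_extended_probe D x.
Proof.
move=> a b fr s0 zt a_gt0 small.
have x_gt0 := height_end_gt0 _ _ _ _ _ _ _ _ fr s0 a_gt0 small.
have [se te sf tf c_gt0 f_ge1 w_ge1] := fr.
have C_gt0 : 0 < c%:~R :> R by rewrite ltr0z.
have z_in : region D z by case: zt => -[].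
have tz0 : height t z = 0 by case: zt => -[].
have e_prim := pairing1_primitive _ _ _ se.
pose w := end_dir e f c.
have tw : pairing (conormal t) (to_plane w) = 1 :> R.
  by rewrite pairing_end_dir te tf mulr0 add0r.
have sw : pairing (conormal s) (to_plane w) = c%:~R :> R.
  by rewrite pairing_end_dir se sf mulr1 addr0.
have w_prim := pairing1_primitive _ _ _ tw.
have sxE : height s x = a by rewrite /height s0 addr0.
pose tau := height t x.
have tau_gt0 : 0 < tau by exact: x_gt0.
(* The length [l] is where the ray from the base of [P] meets [Q], at parameter
   [tau]. *)
pose l := height s z + c%:~R * tau.
have a_lt_l : a < l.
  have : a / c%:~R < tau.
    by have := small t; rewrite /tau /height -/b; lra.
  rewrite ltr_pdivrMr// mulrC => a_lt.
  by rewrite /l (lt_le_trans a_lt)// lerDr z_in.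
pose y := x + (- a) *: to_plane e.
have tipE : y + l *: to_plane e = z + tau *: to_plane w.
  apply: (frame_inj _ _ _ _ _ _ _ _ _ fr).
    by rewrite !pairingDZ se sw -/a /l /height s0; ring.
  by rewrite !pairingDZ te tw /tau /height; move: tz0; rewrite /height; lra.
(* Going out to [T] along [Q] makes each height at least [T], while the flag
   changes it by at most [2 a K]. *)
pose K := \sum_(i : side D) `|pairing (conormal i) (to_plane e) : R|.
pose T := 2 * a * K.
(* A flag of width [2 a] suffices, since the distance from [x] to [s] is [a] and
   [l] is positive. *)
exists (Probe y s e l), (Probe z t w (T + tau + 1)).
exists (z + T *: to_plane w), (z + (T + tau + 1) *: to_plane w), (2 * a).
have Q_in (r : R) : 0 <= r -> region D (z + r *: to_plane w).
  move=> r_ge0 i; rewrite heightDZ addr_ge0 ?z_in// mulr_ge0//.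
  exact: le_trans ler01 (w_ge1 i).
have T_ge0 : 0 <= T by apply: mulr_ge0; [lra | exact: sumr_ge0].
have y_gt0 i : i != s -> 0 < height i y.
  move=> i_s; rewrite (height_frame _ _ s t i e f c _ fr) !pairingDZ se te -/a -/b.
  have r_gt0 : 0 < a / c%:~R by rewrite divr_gt0.
  have := small i; have := small s; rewrite s0 oppr0 => b_gt small_i.
  have : 0 <= b * (pairing (conormal i) (to_plane f) - 1).
    by apply: mulr_ge0; have := f_ge1 i i_s; lra.
  rewrite mulr1 mulr0 subrr mul0r; lra.
have y_in : facet_interior s y.
  by apply: facet_interior_gt0 => //; rewrite heightDZ se sxE; ring.
split.
- split; last first.
  + exists tau; rewrite /tip /= tipE; split=> //=; lra.
  + split=> //=; first by lra.
    by move=> _ [r [/andP[r_ge0 _] ->]]; exact: Q_in.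
  + split=> //=; first by lra.
    move=> _ [r [/andP[r_ge0 r_le] ->]] i; rewrite /= in r_le *.
    have tip_ge0 : 0 <= height i (y + l *: to_plane e) by rewrite tipE Q_in ?ltW.
    have y_ge0 : 0 <= height i y by case: y_in => -[].
    move: tip_ge0; rewrite 2!(heightDZ _ _ _ y).
    by have [p_ge0|p_lt0] := lerP 0 (pairing (conormal i) (to_plane e) : R); nra.
- by [].
- split=> /=; last by lra.
  + by exists T; split=> //=; lra.
  + by exists (T + tau + 1); split=> //=; lra.
- apply: convex_hull_region => j i.
  have gap : 2 * a * `|pairing (conormal i) (to_plane e) : R| <= T.
    apply: ler_wpM2l; first by lra.
    by rewrite /K (bigD1 i)//= lerDl sumr_ge0.
  have flag_in (r : R) : T <= r ->
      0 <= height i (z + r *: to_plane w + (2 * a) *: to_plane e).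
    move=> T_r; rewrite !heightDZ; have := z_in i; have := w_ge1 i; rewrite -/w.
    have := ler_norm (- pairing (conormal i) (to_plane e) : R); rewrite normrN.
    by nra.
  rewrite (tnth_nth 0); case: j => -[|[|[|[|//]]]] _ /=.
  + exact: Q_in.
  + by apply: Q_in; lra.
  + by apply: flag_in; lra.
  + by apply: flag_in; lra.
- split.
  + exists a; split; first by rewrite a_gt0 a_lt_l.
    by rewrite /y -addrA -scalerDl addNr scale0r addr0.
  + rewrite /dist_facet sxE gtr0_norm//=; lra.
  + exists (tau + 1); split.
      exists w, (- (tau + 1)); split=> //; last by rewrite normrN gtr0_norm//; lra.
      by rewrite opprD addrACA subrr add0r -scalerBl; congr (_ *: _); ring.
    by rewrite /dist_facet /tip /= tipE heightDZ tw tz0 add0r mulr1 gtr0_norm//; lra.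
Qed.

(** * The continued fraction and its conormals *)

(** The increments do not decrease:
    [g (j+2) - g (j+1) = (E j - 2) g (j+1) + (g (j+1) - g j)]. *)
Lemma convex_recurrence_ge1 (R : realDomainType) (E g : nat -> R) (N : nat) :
  (forall j, (j.+2 <= N)%N -> 2 <= E j /\ g j.+2 = E j * g j.+1 - g j) ->
  1 <= g 1%N -> g 0%N <= g 1%N ->
  forall j, (j < N)%N -> 1 <= g j.+1 /\ g 1%N - g 0%N <= g j.+1 - g j.
Proof.
move=> rec g1 g01; elim=> [|j IH] jN; first by [].
have [gj dj] := IH (ltnW jN); have [Ej ->] := rec j jN.
have : 0 <= (E j - 2) * g j.+1 by apply: mulr_ge0; lra.
by split; lra.
Qed.

Lemma ceil_ratio_bounds (a b : int) : 0 < b ->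
  (ceil_ratio a b - 1) * b < a /\ a <= ceil_ratio a b * b.
Proof.
move=> b_gt0; have b_gt0Q : 0 < b%:Q by rewrite ltr0z.
have /andP[lo hi] := ceil_itv (a%:Q / b%:Q); rewrite -/(ceil_ratio a b) in lo hi.
split.
  by move: lo; rewrite ltr_pdivlMr// -intrM ltr_int.
by move: hi; rewrite ler_pdivrMr// -intrM ler_int.
Qed.

Lemma hj_remSS (m n j : nat) :
  hj_rem m n j.+2 = hj_coef m n j.+1 * hj_rem m n j.+1 - hj_rem m n j.
Proof. by []. Qed.

Lemma hj_rem_decreasing (m n k : nat) :
  (0 < n)%N -> (n < m)%N -> hj_length m n k ->
  forall j, (j <= k)%N -> 0 <= hj_rem m n j.+1 < hj_rem m n j.
Proof.
move=> n_gt0 n_lt_m [_ rem_neq0]; elim=> [|j IH] jk; first by rewrite /= ltz_nat n_lt_m.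
have /andP[rem_ge0 _] := IH (ltnW jk).
have rem_gt0 : 0 < hj_rem m n j.+1 by rewrite lt_def rem_neq0.
have [lo hi] := ceil_ratio_bounds (hj_rem m n j) (hj_rem m n j.+1) rem_gt0.
rewrite -/(hj_coef m n j.+1) in lo hi; rewrite hj_remSS.
by apply/andP; split; lra.
Qed.

Lemma hj_coef_ge2 (m n k : nat) :
  (0 < n)%N -> (n < m)%N -> hj_length m n k ->
  forall j, (j < k)%N -> 2 <= hj_coef m n j.+1.
Proof.
move=> n_gt0 n_lt_m len_k j jk.
have /andP[rem_ge0 rem_lt] := hj_rem_decreasing _ _ _ n_gt0 n_lt_m len_k j (ltnW jk).
have rem_gt0 : 0 < hj_rem m n j.+1 by rewrite lt_def rem_ge0 andbT; apply: len_k.2.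
have [_] := ceil_ratio_bounds (hj_rem m n j) (hj_rem m n j.+1) rem_gt0.
rewrite -/(hj_coef m n j.+1); nia.
Qed.

Lemma hj_conormal_rem (m n j : nat) :
  (hj_conormal (hj_coef m n) j).1 * m%:Z + (hj_conormal (hj_coef m n) j).2 * n%:Z
    = hj_rem m n j.
Proof.
suff [] : (hj_conormal (hj_coef m n) j).1 * m%:Z
    + (hj_conormal (hj_coef m n) j).2 * n%:Z = hj_rem m n j /\
  (hj_conormal (hj_coef m n) j.+1).1 * m%:Z
    + (hj_conormal (hj_coef m n) j.+1).2 * n%:Z = hj_rem m n j.+1 by [].
elim: j => [|j [IH0 IH1]]; first by split=> /=; ring.
by split=> //; rewrite hj_remSS -IH0 -IH1 hj_conormalSS /=; ring.
Qed.

(** Put [eta_k = (a, b)] and [eta_(k+1) = (p, d)].  Pairing with [(m, n)] gives the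
    remainders, so [p m + d n = 0]; with [det (eta_k, eta_(k+1)) = 1] this yields
    [m = d r] for the last nonzero remainder [r], and Bezout shows that [m]
    divides [d], whence [r = 1] and [d = m].  Then [(b, -a)] solves the equation
    that defines [(nt, q)], and [0 < b < m] singles out the minimal solution. *)
Lemma last_conormals (m n k : nat) (nt q : int) :
  (0 < n)%N -> (n < m)%N -> hj_length m n k ->
  m%:Z * q - n%:Z * nt = -1 -> 0 < nt ->
  (forall nt' q' : int, 0 < nt' -> m%:Z * q' - n%:Z * nt' = -1 -> nt <= nt') ->
  hj_conormal (hj_coef m n) k.+1 = (- n%:Z, m%:Z) /\
  hj_conormal (hj_coef m n) k = (- q, nt).
Proof.
move=> n_gt0 n_lt_m len_k bezout nt_gt0 nt_min.
set eta := hj_conormal (hj_coef m n).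
have k_gt0 : (0 < k)%N.
  by case: k len_k {eta} => // -[/= n0 _]; move: n_gt0; rewrite -ltz_nat n0.
have eta2 j : (j < k.+1)%N -> 1 <= (eta j.+1).2 /\ 1 <= (eta j.+1).2 - (eta j).2.
  move=> jk; rewrite -[1 in X in _ /\ X]/((eta 1%N).2 - (eta 0%N).2).
  apply: (@convex_recurrence_ge1 int (fun j => hj_coef m n j.+1)
    (fun j => (eta j).2) k.+1) => //.
  move=> i ik; split; first exact: hj_coef_ge2 len_k _ _.
  by rewrite /eta hj_conormalSS.
have [dk1_ge1 dk_lt] := eta2 k (ltnSn k).
have dk_ge1 : 1 <= (eta k).2.
  by case: k k_gt0 eta2 {len_k dk1_ge1 dk_lt} => // k' _ /(_ k' (ltnW (ltnSn _)))[].
have det := hj_conormal_det (hj_coef m n) k; rewrite -/eta in det.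
have remk1 := hj_conormal_rem m n k.+1; rewrite -/eta len_k.1 in remk1.
have remk := hj_conormal_rem m n k; rewrite -/eta in remk.
have /andP[_ remk_gt0] := hj_rem_decreasing _ _ _ n_gt0 n_lt_m len_k k (leqnn k).
rewrite len_k.1 -remk in remk_gt0.
case: (eta k) (eta k.+1) det remk1 remk_gt0 dk1_ge1 dk_lt dk_ge1 {remk eta2}
  => [a b] [p d] /= det remk1 remk_gt0 d_ge1 b_lt b_ge1.
have m_gt0 : 0 < m%:Z by rewrite ltz_nat (leq_trans _ n_lt_m).
have m_neq0 : m%:Z != 0 by rewrite gt_eqF.
have m_dvd_d : d = m%:Z * (- p * nt - d * q).
  transitivity (d * (n%:Z * nt - m%:Z * q) - (p * m%:Z + d * n%:Z) * nt); last by ring.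
  by rewrite remk1 mul0r subr0 -[_ - _]opprB bezout opprK mulr1.
have d_dvd_m : m%:Z = d * (a * m%:Z + b * n%:Z).
  transitivity (m%:Z * (a * d - b * p) + b * (p * m%:Z + d * n%:Z)); last by ring.
  by rewrite det remk1 mulr0 addr0 mulr1.
have unit_prod : (- p * nt - d * q) * (a * m%:Z + b * n%:Z) = 1.
  by apply: (mulfI m_neq0); rewrite mulrA -m_dvd_d -d_dvd_m mulr1.
have dE : d = m%:Z.
  have cof_gt0 : 0 < - p * nt - d * q.
    by rewrite -(pmulr_rgt0 _ m_gt0) -m_dvd_d; lia.
  rewrite m_dvd_d; move: cof_gt0 unit_prod remk_gt0.
  move: (- p * nt - d * q) (a * m%:Z + b * n%:Z) => u v; nia.
have remk : a * m%:Z + b * n%:Z = 1.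
  by apply: (mulfI m_neq0); rewrite mulr1 [RHS]d_dvd_m dE.
have bE : b = nt.
  have nt_le : nt <= b by apply: (nt_min b (- a)); lia.
  have : b - nt = m%:Z * (a * (b - nt) - b * (a + q)).
    transitivity ((b - nt) * (a * m%:Z + b * n%:Z)
      - b * ((a * m%:Z + b * n%:Z) + (m%:Z * q - n%:Z * nt))).
      by rewrite remk bezout subrr mulr0 subr0 mulr1.
    by ring.
  move: (a * (b - nt) - b * (a + q)) => u b_nt; rewrite dE in b_lt.
  have [u_lt0|u_gt0|u0] := ltgtP u 0.
  - by have := pmulr_rlt0 u m_gt0; rewrite u_lt0 -b_nt; lia.
  - by have : m%:Z <= m%:Z * u by [rewrite ler_peMr//; lia]; lia.
  - by move: b_nt; rewrite u0 mulr0; lia.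
split; congr pair => //.
  by apply: (mulIf m_neq0); move: remk1; rewrite dE; lia.
by apply: (mulIf m_neq0); move: remk bezout; rewrite bE; lia.
Qed.

(** * The two ends of the resolution polygon *)

(** If facet [i] were at most a point, the edges would be among the [k+1] facets
    with index different from [i]. *)
Lemma resolution_facet_nontrivial (R : realType) (m n k : nat)
    (kappa : k.-tuple R) (i : side (resolution_polygon m n kappa)) :
  is_minimal_resolution m n kappa ->
  exists y z : R * R, [/\ facet i y, facet i z & y != z].
Proof.
move=> [_ card_edges]; apply: contrapT => trivial_i.
suff : (`I_k.+2 #<= `I_k.+1)%card by rewrite card_le_II ltnn.
have [_ /card_le_trans] := (card_eqPle _ _).1 card_edges; apply.
pose other (j : nat) := facet (D := resolution_polygon m n kappa) (lift i (inord j)).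
apply: card_le_trans (card_image_le other _); apply: subset_card_le.
move=> F [[j ->] F_nontrivial].
have i_neq_j : i != j by apply/eqP => ij; apply: trivial_i; rewrite ij.
have [j' jE _] := unlift_some i_neq_j.
by exists j' => /=; rewrite /other ?inord_val -?jE.
Qed.

(** The bound on the support constants depends only on the conormals and [x], so
    it can be chosen before [kappa]. *)
Lemma resolution_displaced_near_end (R : realType) (m n k : nat)
    (s t : 'I_k.+2) (e f : int * int) (c : int) (x : R * R) :
  (forall kappa : k.-tuple R,
     end_frame R (resolution_polygon m n kappa) s t e f c) ->
  (s == ord0) || (s == ord_max) ->
  let a : R := pairing (hj_conormal (hj_coef m n) s) x in
  let b : R := pairing (hj_conormal (hj_coef m n) t) x in
  0 < a -> a < c%:~R * b ->
  exists2 eps : R, 0 < eps &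
    forall kappa : k.-tuple R,
      is_minimal_resolution m n kappa ->
      (forall j : 'I_k, `|tnth kappa j| < eps) ->
      interior (region (resolution_polygon m n kappa)) x /\
      displaced_by_extended_probes (resolution_polygon m n kappa) x.
Proof.
move=> frames s_outer a b a_gt0 a_lt.
have c_gt0 : 0 < c%:~R :> R.
  by rewrite ltr0z (slope_gt0 (frames (nseq_tuple k 0))).
have eps_gt0 : 0 < b - a / c%:~R by rewrite subr_gt0 ltr_pdivrMr// mulrC.
exists (b - a / c%:~R) => // kappa kappa_res kappa_small.
have fr := frames kappa.
have s0 : Defs.support (r := resolution_polygon m n kappa) s = 0.
  by case/orP: s_outer => /eqP -> //=; rewrite nth_rcons size_tuple ltnn eqxx.
have small (i : side (resolution_polygon m n kappa)) :
    - Defs.support i < b - a / c%:~R.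
  case: i => -[|j] j_lt /=; first by rewrite oppr0.
  rewrite nth_rcons size_tuple; case: ltnP => [jk|_]; last by case: eqP; rewrite oppr0.
  rewrite (le_lt_trans _ (kappa_small (Ordinal jk)))// (tnth_nth 0) /=.
  by rewrite -normrN ler_norm.
have [y [z [ty tz y_z]]] := resolution_facet_nontrivial _ _ _ _ _ t kappa_res.
have [w tw] := facet_interior_nonempty _ _ _ _ _ _ _ _ _ fr ty tz y_z.
split; first exact/interior_region/(height_end_gt0 _ _ _ _ _ _ _ _ fr s0 a_gt0 small).
by apply: Or33; exact: displaced_near_end fr s0 tw a_gt0 small.
Qed.

Lemma pairing_conormalSS (R : realType) (E : nat -> int) (j : nat) (y : R * R) :
  pairing (hj_conormal E j.+2) y
    = (E j.+1)%:~R * pairing (hj_conormal E j.+1) y - pairing (hj_conormal E j) y.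
Proof. by rewrite /pairing hj_conormalSS /= !intrD !intrN !intrM; ring. Qed.

(** Positivity of a pairing propagates up the recursion from the indices [l] and
    [l+1]. *)
Lemma conormal_pairing_ge1_above (R : realType) (E : nat -> int) (k l : nat)
    (y : R * R) :
  (forall j, (j < k)%N -> 2 <= E j.+1) ->
  1 <= pairing (hj_conormal E l.+1) y ->
  pairing (hj_conormal E l) y <= pairing (hj_conormal E l.+1) y ->
  forall i, (l < i <= k.+1)%N -> 1 <= pairing (hj_conormal E i) y.
Proof.
move=> E_ge2 y1 y01 i /andP[li ik].
have [j iE] : exists j, i = (j.+1 + l)%N by exists (i - l.+1)%N; lia.
rewrite iE in ik *.
have [] // := @convex_recurrence_ge1 R (fun j => (E (j + l).+1)%:~R)
  (fun j => pairing (hj_conormal E (j + l)) y) (k.+1 - l) _ _ _ j; last by lia.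
move=> j' jk; rewrite !addSn pairing_conormalSS; split=> //.
by rewrite -[2]/(2%:~R) ler_int E_ge2//; lia.
Qed.

(** The recursion is symmetric under reversal, so positivity also propagates down
    from the indices [l+1] and [l]. *)
Lemma conormal_pairing_ge1_below (R : realType) (E : nat -> int) (k l : nat)
    (y : R * R) :
  (forall j, (j < k)%N -> 2 <= E j.+1) -> (l <= k)%N ->
  1 <= pairing (hj_conormal E l) y ->
  pairing (hj_conormal E l.+1) y <= pairing (hj_conormal E l) y ->
  forall i, (i <= l)%N -> 1 <= pairing (hj_conormal E i) y.
Proof.
move=> E_ge2 lk y1 y01 i il.
have [j iE jl] : exists2 j, i = (l.+1 - j.+1)%N & (j < l.+1)%N.
  by exists (l - i)%N; lia.
rewrite iE.
have [] // := @convex_recurrence_ge1 R (fun j => (E (l - j)%N)%:~R)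
  (fun j => pairing (hj_conormal E (l.+1 - j)) y) l.+1 _ _ _ j.
- move=> j' jk; have [i' i'E] : exists i', l = (j' + i'.+1)%N.
    by exists (l - j'.+1)%N; lia.
  have -> : (l.+1 - j'.+2 = i')%N by lia.
  have -> : (l.+1 - j'.+1 = i'.+1)%N by lia.
  have -> : (l.+1 - j' = i'.+2)%N by lia.
  have -> : (l - j' = i'.+1)%N by lia.
  split; last by rewrite pairing_conormalSS; ring.
  by rewrite -[2]/(2%:~R) ler_int E_ge2//; lia.
- by rewrite subSS subn0.
- by rewrite subSS !subn0.
Qed.

(** Both [f] and [w] pair to [1] with [eta_1]; then [f] pairs to [0] with [eta_0],
    and [w] to [1] with [eta_2]. *)
Lemma first_end_frame (R : realType) (m n k : nat) (kappa : k.-tuple R) :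
  (forall j, (j < k)%N -> 2 <= hj_coef m n j.+1) -> (0 < k)%N ->
  end_frame R (resolution_polygon m n kappa) ord0 (@Ordinal k.+2 1 isT)
    (1, 0) (0, 1) (hj_coef m n 1 - 1).
Proof.
move=> E_ge2 k_gt0; have E1_ge2 := E_ge2 0%N k_gt0.
have pair0 (v : int * int) :
    pairing (hj_conormal (hj_coef m n) 0) (to_plane v) = v.1%:~R :> R.
  by rewrite /pairing /= mul1r mul0r addr0.
have pair1 (v : int * int) :
    pairing (hj_conormal (hj_coef m n) 1) (to_plane v) = v.2%:~R :> R.
  by rewrite /pairing /= mul1r mul0r add0r.
split=> /=; rewrite ?pair0 ?pair1 //; first by lia.
  case=> -[|i] ik // _.
  by apply: (conormal_pairing_ge1_above _ _ k 0) => //; rewrite ?pair0 ?pair1.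
set w := end_dir _ _ _.
have wE : w = (hj_coef m n 1 - 1, 1) by rewrite /w /end_dir /=; congr pair; ring.
have pair2 : pairing (hj_conormal (hj_coef m n) 2) (to_plane w) = 1 :> R.
  by rewrite pairing_conormalSS pair0 pair1 wE /= intrB; ring.
case=> i ik /=; case: i ik => [|[|i]] ik.
- by rewrite pair0 wE /= ler1z; lia.
- by rewrite pair1 wE.
- apply: (conormal_pairing_ge1_above _ _ k 1) => //.
  + by rewrite pair2.
  + by rewrite pair1 pair2 wE.
Qed.

(** The mirror image: [f] pairs to [0] with [eta_(k+1)] and [w] to [1] with
    [eta_(k-1)], and both pair to [1] with [eta_k]. *)
Lemma last_end_frame (R : realType) (m n k : nat) (nt q : int)
    (kappa : k.-tuple R) :
  (forall j, (j < k)%N -> 2 <= hj_coef m n j.+1) -> (0 < k)%N ->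
  m%:Z * q - n%:Z * nt = -1 ->
  hj_conormal (hj_coef m n) k.+1 = (- n%:Z, m%:Z) ->
  hj_conormal (hj_coef m n) k = (- q, nt) ->
  end_frame R (resolution_polygon m n kappa) ord_max (widen_ord (leqnSn _) ord_max)
    (- nt, - q) (m%:Z, n%:Z) (hj_coef m n k - 1).
Proof.
move=> E_ge2 k_gt0 bezout etak1 etak.
have Ek_ge2 : 2 <= hj_coef m n k by rewrite -(prednK k_gt0) E_ge2// prednK.
have pairE (eta v : int * int) :
    pairing eta (to_plane v) = (eta.1 * v.1 + eta.2 * v.2)%:~R :> R.
  by rewrite intrD !intrM.
have se : pairing (hj_conormal (hj_coef m n) k.+1) (to_plane (- nt, - q)) = 1 :> R.
  by rewrite pairE etak1 -[1]/(1%:~R) /=; congr (_%:~R); lia.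
have te : pairing (hj_conormal (hj_coef m n) k) (to_plane (- nt, - q)) = 0 :> R.
  by rewrite pairE etak -[0]/(0%:~R) /=; congr (_%:~R); lia.
have sf : pairing (hj_conormal (hj_coef m n) k.+1) (to_plane (m%:Z, n%:Z)) = 0 :> R.
  by rewrite pairE etak1 -[0]/(0%:~R) /=; congr (_%:~R); lia.
have tf : pairing (hj_conormal (hj_coef m n) k) (to_plane (m%:Z, n%:Z)) = 1 :> R.
  by rewrite pairE etak -[1]/(1%:~R) /=; congr (_%:~R); lia.
split=> //=; first by lia.
  case=> i ik i_max /=; apply: (conormal_pairing_ge1_below _ _ k k) => //.
  - by rewrite tf.
  - by rewrite sf tf.
  - by rewrite -ltnS ltn_neqAle -ltnS ik andbT.
set w := end_dir _ _ _.
have sw : pairing (hj_conormal (hj_coef m n) k.+1) (to_plane w)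
    = (hj_coef m n k)%:~R - 1 :> R.
  by rewrite pairing_end_dir se sf intrB; ring.
have tw : pairing (hj_conormal (hj_coef m n) k) (to_plane w) = 1 :> R.
  by rewrite pairing_end_dir te tf mulr0 add0r.
have pw : pairing (hj_conormal (hj_coef m n) k.-1) (to_plane w) = 1 :> R.
  have := pairing_conormalSS R (hj_coef m n) k.-1 (to_plane w).
  by rewrite (prednK k_gt0) sw tw; lra.
have [k' kE] : exists k', k = k'.+1 by exists k.-1; rewrite prednK.
case=> i ik /=.
have [->|i_k1] := eqVneq i k.+1.
  have : 2 <= (hj_coef m n k)%:~R :> R by rewrite -[2]/(2%:~R) ler_int.
  by rewrite sw; lra.
have [->|i_k] := eqVneq i k; first by rewrite tw.
apply: (conormal_pairing_ge1_below _ _ k k.-1) => //; first by lia.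
- by rewrite pw.
- by rewrite prednK// tw pw.
- by lia.
Qed.

Theorem proposition4p4p4 (R : realType) (m n k : nat) (nt q : int) (x : R * R)
  (n_ge2 : (2 <= n)%N) (n_lt_m : (n < m)%N) (coprime_mn : coprime m n)
  (k_length : hj_length m n k)
  (bezout : m%:Z * q - n%:Z * nt = -1)
  (nt_gt0 : 0 < nt)
  (nt_min : forall nt' q' : int,
      0 < nt' -> m%:Z * q' - n%:Z * nt' = -1 -> nt <= nt')
  (x_int : interior (@cone R m n) x)
  (x_region :
     let E1 : R := (hj_coef m n 1)%:~R in
     let Ek : R := (hj_coef m n k)%:~R in
     ~ ((E1 - 1) * x.2 <= x.1 /\
        x.1 <= (m%:R - (Ek - 1) * nt%:~R) / (n%:R - (Ek - 1) * q%:~R) * x.2)) :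
  exists2 eps : R, 0 < eps &
    forall kappa : k.-tuple R,
      is_minimal_resolution m n kappa ->
      (forall j : 'I_k, `|tnth kappa j| < eps) ->
      interior (region (resolution_polygon m n kappa)) x /\
      displaced_by_extended_probes (resolution_polygon m n kappa) x.
Proof.
have n_gt0 : (0 < n)%N by exact: ltnW.
have k_gt0 : (0 < k)%N.
  by case: k k_length {x_region} => // -[/= n0 _]; move: n_gt0; rewrite -ltz_nat n0.
have E_ge2 := hj_coef_ge2 _ _ _ n_gt0 n_lt_m k_length.
have [etak1 etak] := last_conormals _ _ _ _ _ n_gt0 n_lt_m k_length bezout nt_gt0 nt_min.
have [x_first|x_not_first] := ltrP x.1 (((hj_coef m n 1)%:~R - 1) * x.2).
  apply: (resolution_displaced_near_end _ _ _ _ ord0 (@Ordinal k.+2 1 isT)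
    (1, 0) (0, 1) (hj_coef m n 1 - 1)) => //.
  - by move=> kappa; exact: first_end_frame.
  - apply: (interior_halfplane_gt0 _ _ (1, 0) _ _ _ _ x_int) => [|y [y1 _]].
    + by rewrite /pairing /= mul1r mul0r addr0.
    + by rewrite /pairing /= mul1r mul0r addr0.
  - by rewrite /pairing /= !mul1r !mul0r addr0 add0r intrB.
have x_last : (m%:R - ((hj_coef m n k)%:~R - 1) * nt%:~R)
    / (n%:R - ((hj_coef m n k)%:~R - 1) * q%:~R) * x.2 < x.1.
  by rewrite ltNge; apply/negP => x_le; exact: x_region.
have frame := fun kappa => last_end_frame R _ _ _ _ _ kappa E_ge2 k_gt0 bezout etak1 etak.
(* [(W1, W2)] is the direction [w] for the side [k+1], so the slope in the
   hypothesis is that of the boundary ray of the sector. *)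
set W1 : R := m%:R - _ * nt%:~R in x_last *.
set W2 : R := n%:R - _ * q%:~R in x_last *.
(* [w] pairs positively with [(1, 0)] and with [(-n, m)]. *)
have W2_gt0 : 0 < W2.
  have [_ _ _ _ _ _ w_ge1] := frame (nseq_tuple k 0).
  have pair_w (eta : int * int) : pairing eta (to_plane (end_dir (- nt, - q)
      (m%:Z, n%:Z) (hj_coef m n k - 1))) = eta.1%:~R * W1 + eta.2%:~R * W2 :> R.
    rewrite /W1 /W2; move: (hj_coef m n k) => Ek.
    rewrite /pairing /= !intrD !intrM !intrN.
    by rewrite -[m%:R]/((m%:Z)%:~R) -[n%:R]/((n%:Z)%:~R); ring.
  have W1_ge1 : 1 <= W1 by have := w_ge1 ord0; rewrite pair_w /=; lra.
  have n_pos : 0 < n%:R :> R by rewrite ltr0n.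
  have m_pos : 0 < m%:R :> R by rewrite ltr0n (ltn_trans n_gt0).
  have : 1 <= - n%:R * W1 + m%:R * W2.
    by have := w_ge1 ord_max; rewrite pair_w [conormal _]etak1 /= intrN.
  rewrite -(pmulr_rgt0 _ m_pos); have := mulr_gt0 n_pos (lt_le_trans ltr01 W1_ge1).
  lra.
apply: (resolution_displaced_near_end _ _ _ _ _ _ _ _ _ _ frame).
- by rewrite eqxx orbT.
- rewrite etak1; apply: (interior_halfplane_gt0 _ _ (- nt, - q) _ _ _ _ x_int) 
    => [|y [_ y2]].
  + have := pair_se (frame (nseq_tuple k 0)).
    by rewrite -etak1.
  + by move: y2; rewrite /pairing /= intrN.
- rewrite etak1 etak; move: x_last; rewrite mulrAC ltr_pdivrMr// /W1 /W2.
  move: (hj_coef m n k) => Ek; rewrite /pairing /= intrB !intrN.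
  rewrite -[m%:R]/((m%:Z)%:~R) -[n%:R]/((n%:Z)%:~R); lra.
Qed.
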